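(* Let $f\colon \mathbb{R}^n\to\mathbb{R}$ be convex and differentiable with $\operatorname{argmin} f\neq\emptyset$. Let $X_0\in\mathbb{R}^n$ and let $X\colon[0,\infty)\to\mathbb{R}^n$ be a solution of the Nesterov ODE $$\ddot X(t)+\frac{3}{t}\dot X(t)+\nabla f(X(t))=0\quad\text{for } t>0,\qquad X(0)=X_0,\quad \dot X(0)=0.$$ Then $X(t)$ converges to a minimizer of $f$ as $t\to\infty$; that is, there exists $X_\infty\in\operatorname{argmin} f$ such that $X(t)\to X_\infty$ as $t\to\infty$.
   Context: $\mathbb{R}^n$ carries the Euclidean inner product and norm. $\operatorname{argmin} f$ denotes the set of minimizers of $f$ over $\mathbb{R}^n$. A solution means a function $X$ that is continuously differentiable on $[0,\infty)$ and twice continuously differentiable on $(0,\infty)$, satisfying the ODE on $(0,\infty)$ together with the stated initial conditions. *)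

(* Defs.v *)
From mathcomp Require Import all_boot all_order all_algebra.
From mathcomp Require Import all_classical all_reals all_analysis.
Import Order.TTheory GRing.Theory Num.Theory.
Import numFieldNormedType.Exports.

Set Implicit Arguments.
Unset Strict Implicit.
Unset Printing Implicit Defensive.

Local Open Scope ring_scope.
Local Open Scope classical_set_scope.

Definition argmin (T : Type) (R : realType) (f : T -> R) : set T :=
  [set x | forall y, f x <= f y].

Definition dotprod (R : realType) (n : nat) (u v : 'rV[R]_n) : R :=
  \sum_i u ord0 i * v ord0 i.

(* The library's norm on 'rV[R]_n is the sup norm.  Differentiability, limits
   and continuity do not depend on the choice of a norm on R^n; the Euclidean
   structure only enters through the gradient, see gradientP. *)
Definition gradient (R : realType) (n : nat) (f : 'rV[R]_n -> R)
    (x : 'rV[R]_n) : 'rV[R]_n :=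
  \row_i 'D_(delta_mx ord0 i) f x.

Lemma gradientP (R : realType) (n : nat) (f : 'rV[R]_n -> R) (x v : 'rV[R]_n) :
  differentiable f x -> 'd f x v = dotprod (gradient f x) v.
Proof.
move=> df; rewrite [v in LHS]row_sum_delta linear_sum; apply: eq_bigr => i _.
by rewrite linearZ /= mxE (deriveE _ df) mulrC.
Qed.

(* Differentiation relative to a set D, i.e. with difference quotients
   restricted to D: at the end point 0 of D = [0, +oo[ this is the
   right derivative. *)
Section derive_within.
Context {R : realType} {V : normedModType R}.
Implicit Types (D : set R) (X : R -> V) (t : R).

Definition derivable_within D X t :=
  cvg (h^-1 *: (X (h + t) - X t) @[h --> within [set h | D (h + t)] 0^']).

Definition derive_within D X t : V :=
  lim (h^-1 *: (X (h + t) - X t) @[h --> within [set h | D (h + t)] 0^']).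

Definition continuously_derivable_within D X :=
  (forall t, D t -> derivable_within D X t) /\
  {within D, continuous (derive_within D X)}.

Lemma derive_within_interior D X t :
  D° t -> derive_within D X t = X^`() t.
Proof.
move=> Dt; rewrite /derive_within /derive1.
suff -> : within [set h | D (h + t)] 0^' = 0^' by [].
have D0 : \forall h \near 0^', D (h + t).
  apply: nbhs_dnbhs; move: Dt; rewrite /interior /= -{1}[t]add0r => Dt.
  exact: (@cvgD _ _ _ _ _ id (cst t) 0 t cvg_id (cvg_cst t)).
apply/seteqP; split => A hA; rewrite /within/= in hA *.
  by near=> h; near: h; move: hA; apply: filter_app; near=> h; apply; near: h.
by near=> h => _; near: h.
Unshelve. all: by end_near. Qed.

End derive_within.

(* The trajectory [0, +oo[ -> R^n is represented by a total function X, whose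
   values at negative times play no role. *)
Record nesterov_solution (R : realType) (n : nat) (f : 'rV[R]_n -> R)
    (X0 : 'rV[R]_n) (X : R -> 'rV[R]_n) : Prop := NesterovSolution {
  nesterov_C1 : continuously_derivable_within `[0, +oo[ X ;
  nesterov_derivable : forall t : R, 0 < t -> derivable X t 1 ;
  nesterov_derivable2 : forall t : R, 0 < t -> derivable X^`() t 1 ;
  nesterov_C2 : forall t : R, 0 < t -> {for t, continuous X^`(2)} ;
  nesterov_ode : forall t : R, 0 < t ->
    X^`(2)%classic t + (3 / t) *: X^`()%classic t + gradient f (X t) = 0 ;
  nesterov_init : X 0 = X0 ;
  nesterov_init_derive : derive_within `[0, +oo[ X 0 = 0 }.

(* Main.v *)
(* For every z, convexity makes
     E_z(t) = t^2 (f(X) - f(z)) + |t X' + 2 (X - z)|^2 / 2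
   nonincreasing on t > 0.  If z is a minimizer then E_z >= 0, so E_z converges,
   t X' + 2 (X - z) is bounded and f(X) -> min f.  Since (t^2 u)' = t (t u' + 2 u),
   a bound on t u' + 2 u bounds u, and convergence of t u' + 2 u to L forces
   u -> L / 2.  Hence X is bounded and its cluster points are minimizers.  For two
   minimizers p, q, convergence of E_p - E_q says that t h' + 2 h converges for
   h = <X, p - q>, so h converges; if p and q are both cluster points then
   <p, p - q> = lim h = <q, p - q>, that is, p = q. *)
Require Import Defs.
From mathcomp Require Import all_boot all_order all_algebra.
From mathcomp Require Import all_classical all_reals all_analysis.
From mathcomp Require Import ring lra.
Import Order.TTheory GRing.Theory Num.Theory.
Import numFieldNormedType.Exports.

Local Open Scope ring_scope.
Local Open Scope classical_set_scope.

(** * Differential inequalities for the Euler operator t u' + 2 u *)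

Lemma is_derive_nincry (R : realType) (F dF : R -> R) (T : R) :
    (forall t, T <= t -> is_derive t 1 F (dF t)) ->
    (forall t, T <= t -> dF t <= 0) ->
  forall s t, T <= s -> s <= t -> F t <= F s.
Proof.
move=> dFE dF0; apply: ler0_derive1_nincry.
- by move=> t; rewrite in_itv/= andbT => /ltW/dFE[].
- move=> t; rewrite in_itv/= andbT => /ltW Tt.
  by have [_] := dFE t Tt; rewrite derive1E => ->; exact: dF0.
- apply: derivable_within_continuous => t.
  by rewrite in_itv/= andbT => /dFE[].
Qed.

(** The derivative of t^2 (u - C / 2) is t (t u' + 2 u - C), which is nonpositive. *)
Lemma euler_ineq (R : realType) (u du : R -> R) (T C : R) : 0 < T ->
    (forall t, T <= t -> is_derive t 1 u (du t)) ->
    (forall t, T <= t -> t * du t + 2 * u t <= C) ->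
  forall t, T <= t -> t ^+ 2 * (u t - C / 2) <= T ^+ 2 * (u T - C / 2).
Proof.
move=> T0 duE duC t Tt.
apply: (@is_derive_nincry _ (fun t => t ^+ 2 * (u t - C / 2))
  (fun t => t * (t * du t + 2 * u t - C)) T) => // s Ts.
- have := duE s Ts => duEs; apply: is_derive_eq.
  by rewrite /GRing.scale/=; field.
- by rewrite pmulr_rle0 ?(lt_le_trans T0)// subr_le0 duC.
Qed.

(** The one-sided inequality is used for u with constant L + C and for -u with constant C - L; the
    leftover term -T^2 C / 2 on the right is dropped. *)
Lemma euler_bound (R : realType) (u du : R -> R) (T L C : R) : 0 < T ->
    (forall t, T <= t -> is_derive t 1 u (du t)) ->
    (forall t, T <= t -> `|t * du t + 2 * u t - L| <= C) ->
  forall t, T <= t -> t ^+ 2 * (`|u t - L / 2| - C / 2) <= T ^+ 2 * `|u T - L / 2|.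
Proof.
move=> T0 duE duC t Tt.
have T20 : 0 <= T ^+ 2 by rewrite sqr_ge0.
have C0 : 0 <= C by rewrite (le_trans _ (duC T (lexx _))).
have TC0 : 0 <= T ^+ 2 * C by rewrite mulr_ge0.
have h1 : t ^+ 2 * (u t - (L + C) / 2) <= T ^+ 2 * (u T - (L + C) / 2).
  apply: (@euler_ineq _ u du) => // s /duC; rewrite ler_norml => /andP[]; lra.
have h2 : t ^+ 2 * (- u t - (C - L) / 2) <= T ^+ 2 * (- u T - (C - L) / 2).
  apply: (@euler_ineq _ (fun x => - u x) (fun x => - du x)) => // s Ts.
    by have := duE s Ts => ?; exact: is_deriveN.
  by move: (duC s Ts); rewrite ler_norml => /andP[]; lra.
have h3 : T ^+ 2 * (u T - L / 2) <= T ^+ 2 * `|u T - L / 2|.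
  by rewrite ler_wpM2l// ler_norm.
have h4 : T ^+ 2 * (L / 2 - u T) <= T ^+ 2 * `|u T - L / 2|.
  by rewrite ler_wpM2l// distrC ler_norm.
have [_|_] := ler0P (u t - L / 2); nra.
Qed.

Lemma euler_cvg (R : realType) (u du : R -> R) (T L : R) : 0 < T ->
    (forall t, T <= t -> is_derive t 1 u (du t)) ->
    t * du t + 2 * u t @[t --> +oo] --> L ->
  u t @[t --> +oo] --> L / 2.
Proof.
move=> T0 duE /cvgrPdist_le duL; apply/cvgrPdist_le => e e0.
have [S [_ duS]] := duL e e0.
(* The tail bound holds only strictly beyond S, hence the shift by 1. *)
pose S' := Num.max (S + 1) T.
have S'0 : 0 < S' by rewrite lt_max T0 orbT.
have SS' : S < S' by rewrite lt_max ltrDl ltr01.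
have TS' : T <= S' by rewrite le_max lexx orbT.
have uL := @euler_bound _ u du S' L e S'0
  (fun t S't => duE t (le_trans TS' S't))
  (fun t S't => ltac:(rewrite distrC; exact: (duS t (lt_le_trans SS' S't)))).
pose K := S' ^+ 2 * `|u S' - L / 2|.
near=> t.
have S't : S' <= t by near: t; exact: nbhs_pinfty_ge (num_real _).
have t1 : 1 <= t by near: t; exact: nbhs_pinfty_ge (num_real _).
(* Makes the initial contribution K / t^2 at most e / 2, since t <= t^2. *)
have Kt : 2 * K / e <= t by near: t; exact: nbhs_pinfty_ge (num_real _).
have {}Kt : 2 * K <= t ^+ 2 * e.
  move: Kt; rewrite ler_pdivrMr// => /le_trans; apply.
  by rewrite ler_pM2r// expr2 ler_peMl// (le_trans _ t1).
rewrite distrC -(@ler_pM2l _ (t ^+ 2)) ?exprn_gt0 ?(lt_le_trans S'0)//.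
by move: (uL t S't); rewrite -/K; lra.
Unshelve. all: by end_near. Qed.

(** * Convexity and cluster points *)

(** For 0 < h <= 1, convexity bounds the difference quotient along y - x by f y - f x; the
    directional derivative is its limit as h decreases to 0. *)
Lemma convex_grad_le (R : realType) (V : normedModType R) (f : V -> R) (x y : V) :
    @convex_function R V [set: V] f -> differentiable f x ->
  f x + 'd f x (y - x) <= f y.
Proof.
move=> cf df; rewrite -lerBrDl -deriveE//.
have dfv : derivable f x (y - x) by exact: diff_derivable.
rewrite /derive cvg_at_rightE; last exact: dfv.
apply: limr_le.
  apply/cvg_ex; exists ('D_(y - x) f x) => A /dfv /nbhs_ballP[_ /posnumP[e] eA].
  by exists e%:num => //= h eh /gt_eqF/negbT; exact: eA.
near=> h.
have h0 : 0 < h by near: h; exact: nbhs_right_gt.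
have h1 : h <= 1 by near: h; exact: nbhs_right_le.
rewrite -[_ *: _]/(h^-1 * (f (h *: (y - x) + x) - f x)) ler_pdivrMl// lerBlDl.
have -> : h *: (y - x) + x = h *: y + (1 - h) *: x.
  by rewrite scalerBr scalerBl scale1r addrAC addrA.
have := cf (Itv01 (ltW h0) h1) y x (in_setT _) (in_setT _).
by rewrite convRE/= => /le_trans; apply; rewrite /unstable.onem; lra.
Unshelve. all: by end_near. Qed.

(** By continuity every neighbourhood of [g p] meets every neighbourhood of [l]; Hausdorff
    separation identifies the two. *)
Lemma cluster_cvg_comp (T U V : topologicalType) (F : set_system T)
    (X : T -> U) (g : U -> V) (p : U) (l : V) :
    hausdorff_space V -> {for p, continuous g} ->
    cluster (X @ F) p -> g (X t) @[t --> F] --> l -> g p = l.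
Proof.
move=> hV gp Xp gl; apply/esym/hV => A B Al /gp Bp.
have [q [Aq Bq]] := Xp (g @^-1` A) _ (gl A Al) Bp.
by exists (g q).
Qed.

(** If a neighbourhood U of p were not in F, the trace of F on the complement of U would be proper
    and have a cluster point q in K. Then q is also a cluster point of F, so q = p, which U
    excludes. *)
Lemma compact_cvg_cluster1 (T : topologicalType) (F : set_system T) (K : set T) :
    ProperFilter F -> compact K -> F K ->
    (forall p q, cluster F p -> cluster F q -> p = q) ->
  exists2 p, cluster F p & F --> p.
Proof.
move=> PF cK FK F1.
have [p [Kp Fp]] := cK F PF FK.
exists p => // U nU; apply: contrapT => nFU.
have PG : ProperFilter (within (~` U) F).
  apply: Build_ProperFilter_ex => A; rewrite /within/= => FA.
  apply: contrapT => A0; apply: nFU; apply: filterS FA => z zA.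
  by apply: contrapT => nUz; apply: A0; exists z; exact: zA.
have GK : within (~` U) F K by apply: filterS FK => z + _.
have [q [_ Gq]] := cK _ PG GK.
have qp : q = p.
  apply: F1 => //.
  by apply: (@cvg_cluster _ (within (~` U) F) F) => //; exact: cvg_within.
have [|z []//] := Gq (~` U) U (withinT _ _); first by rewrite qp.
Qed.

(** * Derivatives along the trajectory and the energy *)

Lemma is_derive_coord (R : realType) (n : nat) (X : R -> 'rV[R]_n) (t : R) i :
  derivable X t 1 ->
  is_derive t 1 (fun s => X s ord0 i) (X^`()%classic t ord0 i).
Proof.
move=> dX; split; first exact: (derivable_mxP _ _ _).1.
by rewrite derive1E derive_mx// mxE.
Qed.

Lemma is_derive_gradient (R : realType) (n : nat) (f : 'rV[R]_n -> R)
    (X : R -> 'rV[R]_n) (t : R) :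
    differentiable f (X t) -> derivable X t 1 ->
  is_derive t 1 (fun s => f (X s)) (dotprod (gradient f (X t)) (X^`()%classic t)).
Proof.
move=> df /derivable1_diffP dX.
have dfX : differentiable (f \o X) t by exact: differentiable_comp.
split; first exact/derivable1_diffP.
by rewrite (deriveE _ dfX) diff_comp//= -gradientP// derive1E deriveE.
Qed.

(** The function E_z of the overview; the squared Euclidean norm is spelled out as a sum because the
    norm on ['rV[R]_n] is the sup norm. *)
Definition energy {R : realType} {n : nat} (f : 'rV[R]_n -> R)
    (X : R -> 'rV[R]_n) (z : 'rV[R]_n) (t : R) : R :=
  t ^+ 2 * (f (X t) - f z) +
  2^-1 * \sum_i (t * X^`()%classic t ord0 i + 2 * (X t ord0 i - z ord0 i)) ^+ 2.

Lemma energy_ge0 (R : realType) (n : nat) (f : 'rV[R]_n -> R)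
    (X : R -> 'rV[R]_n) (z : 'rV[R]_n) (t : R) :
  argmin f z -> 0 <= energy f X z t.
Proof.
move=> fz; apply: addr_ge0; first by rewrite mulr_ge0 ?sqr_ge0// subr_ge0; exact: fz.
by rewrite mulr_ge0 ?invr_ge0// sumr_ge0// => i _; exact: sqr_ge0.
Qed.

(** * Decay of the energy along a solution *)

Section nesterov.
Context {R : realType} {n : nat} {f : 'rV[R]_n -> R}.
Context {X0 : 'rV[R]_n} {X : R -> 'rV[R]_n}.
Context (f_convex : @convex_function R 'rV[R]_n [set: 'rV[R]_n] f).
Context (f_diff : forall x : 'rV[R]_n, differentiable f x).
Context (X_sol : nesterov_solution f X0 X).

(** By the ODE, t X' + 2 (X - z) has derivative t X'' + 3 X' = -t grad f, so the two terms in <grad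
    f, X'> cancel. *)
Lemma is_derive_energy (z : 'rV[R]_n) (t : R) : 0 < t ->
  is_derive t 1 (energy f X z)
    (2 * t * (f (X t) - f z - dotprod (gradient f (X t)) (X t - z))).
Proof.
move=> t0.
have dX := nesterov_derivable X_sol t0.
have dX' := nesterov_derivable2 X_sol t0.
have ode i : t * X^`(2)%classic t ord0 i + 3 * X^`()%classic t ord0 i =
             - t * gradient f (X t) ord0 i.
  have := nesterov_ode X_sol t0; move: (gradient _ _) => g /rowP/(_ i).
  rewrite !mxE => /eqP; rewrite addrC addr_eq0 => /eqP ->.
  by field; rewrite gt_eqF.
have dfX := is_derive_gradient _ _ f X t (f_diff (X t)) dX.
have dXi i := is_derive_coord _ _ X t i dX.
have dX'i i : is_derive t 1 (fun s => X^`()%classic s ord0 i) (X^`(2)%classic t ord0 i).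
  exact: is_derive_coord.
pose term i (s : R) := (s * X^`()%classic s ord0 i + 2 * (X s ord0 i - z ord0 i)) ^+ 2.
have dterm i : is_derive t 1 (term i)
    (2 * (t * X^`()%classic t ord0 i + 2 * (X t ord0 i - z ord0 i)) *
     (- t * gradient f (X t) ord0 i)).
  have := dXi i; have := dX'i i => ? ?.
  by apply: is_derive_eq; rewrite -ode /GRing.scale/=; ring.
have -> : energy f X z = fun s => s ^+ 2 * (f (X s) - f z) + 2^-1 * (\sum_i term i) s.
  by apply/funext => s; rewrite /energy fct_sumE.
apply: is_derive_eq.
rewrite /GRing.scale/= /dotprod mulr_sumr mulrBr mulr_sumr.
rewrite mulr0 subr0 addrAC -big_split/=.
rewrite (eq_bigr (fun i => - (2 * t) * (gradient f (X t) ord0 i * (X t - z) ord0 i))).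
  by rewrite -mulr_sumr; ring.
by move=> i _; move: (gradient _ _) => g; rewrite !mxE; field.
Qed.

(** The tangent inequality for f at X, evaluated at z, makes the derivative of the energy
    nonpositive. *)
Lemma energy_nincr (z : 'rV[R]_n) (s t : R) :
  0 < s -> s <= t -> energy f X z t <= energy f X z s.
Proof.
move=> s0 st; apply: (is_derive_nincry _ _ _ s) => //.
  by move=> x sx; apply: is_derive_energy; exact: lt_le_trans sx.
move=> x sx /=; rewrite pmulr_rle0 ?mulr_gt0 ?(lt_le_trans s0 sx)// -gradientP//.
have := convex_grad_le _ _ f (X x) z f_convex (f_diff _).
by rewrite -(opprB (X x)) linearN/=; lra.
Qed.

Lemma energy_cvg (z : 'rV[R]_n) : argmin f z -> cvg (energy f X z t @[t --> +oo]).
Proof.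
(* Monotone convergence is applied on the whole line: time is frozen at 1 below 1, and the sign is
   flipped to get a nondecreasing function. *)
move=> fz; pose E t := - energy f X z (Num.max 1 t).
have E_nd : nondecreasing_fun E.
  move=> s t st; rewrite lerN2; apply: energy_nincr => //.
    by rewrite lt_max ltr01.
  by rewrite ge_max !le_max lexx st orbT.
have E_ub : has_ubound (range E).
  exists 0 => _ [t _ <-]; rewrite oppr_le0; exact: energy_ge0.
apply/cvg_ex; exists (- sup (range E)).
apply: cvg_trans (cvgN (nondecreasing_cvgr E_nd E_ub)).
apply: near_eq_cvg; near=> t.
have t1 : 1 <= t by near: t; exact: nbhs_pinfty_ge (num_real _).
by rewrite fctE /E opprK max_r.
Unshelve. all: by end_near. Qed.

(* The terms quadratic in [X] cancel: the difference is affine in the trajectory. *)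
Lemma energy_diff (z1 z2 : 'rV[R]_n) (t : R) : f z1 = f z2 ->
  energy f X z1 t - energy f X z2 t =
  2 * (dotprod z1 z1 - dotprod z2 z2) -
  2 * (t * dotprod (X^`()%classic t) (z1 - z2) + 2 * dotprod (X t) (z1 - z2)).
Proof.
move=> f12; rewrite /energy f12 opprD addrACA subrr add0r /dotprod.
rewrite !mulr_sumr -!sumrB -!big_split/= !mulr_sumr -!sumrB.
by apply: eq_bigr => i _; rewrite !mxE; field.
Qed.

(** * Boundedness, convergence of values and of projections *)

Lemma solution_coord_bounded (z : 'rV[R]_n) i : argmin f z ->
  exists M, forall t, 1 <= t -> `|X t ord0 i - z ord0 i| <= M.
Proof.
(* A coordinate w of t X' + 2 (X - z) satisfies w^2 <= 2 E_z(1), hence |w| <= 2 E_z(1) + 1 without a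
   square root. *)
move=> fz; pose C := 2 * energy f X z 1 + 1.
have E0 : 0 <= energy f X z 1 by exact: energy_ge0.
exists (C / 2 + `|X 1 ord0 i - z ord0 i|) => t t1.
have := euler_bound _ (fun t => X t ord0 i) (fun t => X^`()%classic t ord0 i)
  1 (2 * z ord0 i) C ltr01.
rewrite mulrAC mulfV// mul1r expr1n mul1r => /(_ _ _ t t1) H.
rewrite -lerBlDl leNgt; apply/negP => Mlt.
have {H} : t ^+ 2 * (`|X t ord0 i - z ord0 i| - C / 2) <= `|X 1 ord0 i - z ord0 i|.
  apply: H => s s1.
    exact: is_derive_coord (nesterov_derivable X_sol (lt_le_trans ltr01 s1)).
  have sC : (s * X^`()%classic s ord0 i + 2 * (X s ord0 i - z ord0 i)) ^+ 2 <=
      2 * energy f X z 1.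
    have sum0 : 0 <= \sum_(j | j != i)
        (s * X^`()%classic s ord0 j + 2 * (X s ord0 j - z ord0 j)) ^+ 2.
      by apply: sumr_ge0 => j _; exact: sqr_ge0.
    have fs0 : 0 <= s ^+ 2 * (f (X s) - f z).
      by rewrite mulr_ge0 ?sqr_ge0// subr_ge0; exact: fz.
    have := energy_nincr z _ _ ltr01 s1; rewrite {1}/energy.
    by rewrite (bigD1 i)//=; lra.
  rewrite -addrA -mulrBr ler_norml; apply/andP; split; rewrite /C; nra.
(* Since t^2 >= 1, the factor t^2 only enlarges the nonnegative excess, which already beats the
   deviation at time 1. *)
apply/negP; rewrite -ltNge (lt_le_trans Mlt)// ler_peMl//.
  by rewrite (le_trans _ (ltW Mlt)).
by rewrite exprn_ege1.
Qed.

(** For t >= 1, t^2 (f(X) - f(z)) <= E_z(t) <= E_z(1), so the gap is O(1 / t^2). *)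
Lemma solution_value_cvg (z : 'rV[R]_n) : argmin f z -> f (X t) @[t --> +oo] --> f z.
Proof.
move=> fz; apply/cvgrPdist_le => e e0.
have E0 : 0 <= energy f X z 1 by exact: energy_ge0.
near=> t.
have t1 : 1 <= t by near: t; exact: nbhs_pinfty_ge (num_real _).
have Et : energy f X z 1 / e <= t by near: t; exact: nbhs_pinfty_ge (num_real _).
rewrite distrC ger0_norm ?subr_ge0; last exact: fz.
have := energy_nincr z _ _ ltr01 t1; rewrite {1}/energy => tE.
have sum0 : 0 <= \sum_i (t * X^`()%classic t ord0 i + 2 * (X t ord0 i - z ord0 i)) ^+ 2.
  by apply: sumr_ge0 => j _; exact: sqr_ge0.
have te : energy f X z 1 <= t ^+ 2 * e.
  move: Et; rewrite ler_pdivrMr// => /le_trans; apply.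
  by rewrite ler_pM2r// expr2 ler_peMl// (le_trans _ t1).
rewrite -(@ler_pM2l _ (t ^+ 2)) ?exprn_gt0 ?(lt_le_trans ltr01)//.
by lra.
Unshelve. all: by end_near. Qed.

Lemma dotprod_cvg (z1 z2 : 'rV[R]_n) : argmin f z1 -> argmin f z2 ->
  cvg (dotprod (X t) (z1 - z2) @[t --> +oo]).
Proof.
move=> fz1 fz2.
have f12 : f z1 = f z2 by apply/eqP; rewrite eq_le fz1 fz2.
have /cvg_ex[/= l1 El1] := energy_cvg z1 fz1.
have /cvg_ex[/= l2 El2] := energy_cvg z2 fz2.
pose c := dotprod z1 z1 - dotprod z2 z2.
(* With h = <X, z1 - z2>, the energies differ by 2 c - 2 (t h' + 2 h), so t h' + 2 h tends to c -
   (l1 - l2) / 2 and h to half of that. *)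
apply/cvg_ex; exists ((c - (l1 - l2) / 2) / 2).
apply: (euler_cvg _ _ (fun t => dotprod (X^`()%classic t) (z1 - z2)) 1) => //.
- move=> t t1; rewrite /dotprod.
  have dXi i := is_derive_coord _ _ X t i (nesterov_derivable X_sol (lt_le_trans ltr01 t1)).
  pose term i (s : R) := X s ord0 i * (z1 - z2) ord0 i.
  have dterm i : is_derive t 1 (term i) (X^`()%classic t ord0 i * (z1 - z2) ord0 i).
    by have := dXi i => ?; apply: is_derive_eq; rewrite /GRing.scale/=; ring.
  rewrite (_ : (fun _ => _) = \sum_i term i); first exact: is_derive_sum.
  by apply/funext => s; rewrite fct_sumE.
- have -> : (fun t => t * dotprod (X^`()%classic t) (z1 - z2) + 2 * dotprod (X t) (z1 - z2))
      = (fun t => c - (energy f X z1 t - energy f X z2 t) / 2).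
    by apply/funext => t; rewrite energy_diff// -/c; field.
  by apply: cvgB; [exact: cvg_cst | apply: cvgMr_tmp; exact: cvgB].
Qed.
End nesterov.

(** * Uniqueness of the cluster point and convergence *)

Lemma dotprod_continuous (R : realType) (n : nat) (w : 'rV[R]_n) :
  continuous (fun v => dotprod v w).
Proof.
have sumC := @continuous_big R _ +%R 0 xpredT (@add_continuous R) 'rV[R]_n
  (index_enum 'I_n) (fun i v => v ord0 i * w ord0 i).
apply: sumC => i _ v.
apply: (@cvgMr_tmp _ _ (nbhs v) (nbhs_filter v) (fun v : 'rV_n => v ord0 i)).
exact: coord_continuous.
Qed.

Lemma dotprod_eq0 (R : realType) (n : nat) (v : 'rV[R]_n) :
  dotprod v v = 0 -> v = 0.
Proof.
move=> v0; apply/rowP => i; rewrite mxE.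
have vi : v ord0 i * v ord0 i = 0.
  by apply: (psumr_eq0P _ v0) => // j _; rewrite -expr2 sqr_ge0.
by apply/eqP; rewrite -sqrf_eq0 expr2 vi.
Qed.

Theorem theorem2p2 (R : realType) (n : nat) (f : 'rV[R]_n -> R)
    (f_convex : @convex_function R 'rV[R]_n [set: 'rV[R]_n] f)
    (f_diff : forall x : 'rV[R]_n, differentiable f x)
    (f_argmin : argmin f !=set0)
    (X0 : 'rV[R]_n) (X : R -> 'rV[R]_n)
    (X_sol : nesterov_solution f X0 X) :
  exists2 Xoo : 'rV[R]_n, argmin f Xoo & X t @[t --> +oo] --> Xoo.
Proof.
have [z fz] := f_argmin.
(* By continuity, f at a cluster point is the limit of f(X), the minimum. *)
have cluster_argmin p : cluster (X @ +oo) p -> argmin f p.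
  move=> Xp y; rewrite (_ : f p = f z); first exact: fz.
  apply: (cluster_cvg_comp _ _ _ +oo X f p _ _ _ Xp).
  - exact: norm_hausdorff.
  - exact: differentiable_continuous.
  - exact: solution_value_cvg f_convex f_diff X_sol z fz.
have /choice[M XM] : forall i, exists M, forall t, 1 <= t -> `|X t ord0 i - z ord0 i| <= M.
  by move=> i; exact: solution_coord_bounded f_convex f_diff X_sol z i fz.
(* A compact box containing the trajectory from time 1 on. *)
pose K := [set v : 'rV[R]_n | forall i,
  `[z ord0 i - M i, z ord0 i + M i]%classic (v ord0 i)].
have cK : compact K.
  apply: (@rV_compact R n (fun i => `[z ord0 i - M i, z ord0 i + M i]%classic)).
  by move=> i; exact: segment_compact.
have XK : (X @ +oo) K.
  apply: filterS (nbhs_pinfty_ge (num_real 1)) => t /= t1 i /=.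
  by rewrite in_itv/= -ler_distl XM.
have [|p /cluster_argmin fp Xp] := compact_cvg_cluster1 _ (X @ +oo) K _ cK XK; last by exists p.
(* |p - q|^2 = <p, p - q> - <q, p - q>, and both products equal the limit of <X, p - q>. *)
move=> p q Xp Xq; apply/eqP; rewrite -subr_eq0; apply/eqP/dotprod_eq0.
have /cvg_ex[/= l Xl] := dotprod_cvg f_convex f_diff X_sol p q
  (cluster_argmin p Xp) (cluster_argmin q Xq).
have lim r : cluster (X @ +oo) r -> dotprod r (p - q) = l.
  move=> Xr; apply: (cluster_cvg_comp _ _ _ +oo X (fun v => dotprod v (p - q)) r l _ _ Xr Xl).
    exact: norm_hausdorff.
  exact: dotprod_continuous.
rewrite -[RHS](subrr l) -{1}(lim p Xp) -(lim q Xq) /dotprod -sumrB.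
by apply: eq_bigr => i _; rewrite !mxE; ring.
Qed.
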